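(* Let $H$ be a left skew brace, $I$ an abelian group viewed as a trivial brace, and $(\nu,\mu,\sigma)$ a good triplet of actions of $H$ on $I$. Then there exists a bijection between $\mathrm{H}^2_N(H,I)$ (formed with respect to $(\nu,\mu,\sigma)$) and $\mathrm{Ext}_{(\nu,\mu,\sigma)}(H,I)$.
   Context: A left skew brace is a set $E$ with operations $+,\circ$ such that $(E,+)$ and $(E,\circ)$ are groups (not necessarily abelian) and $a\circ(b+c)=a\circ b-a+a\circ c$ for all $a,b,c$. Both groups have the same identity, denoted $0$; $a^{-1}$ is the inverse in $(E,\circ)$. A brace homomorphism preserves both operations. A trivial brace $I$ is an abelian group $(I,+)$ with $\circ=+$. Good triplet: a triplet $(\nu,\mu,\sigma)$, where $\nu:(H,\circ)\to \mathrm{Aut}(I,+)$ is a group homomorphism and $\mu:(H,+)\to\mathrm{Aut}(I,+)$, $\sigma:(H,\circ)\to\mathrm{Aut}(I,+)$ are group anti-homomorphisms (images of $h$ written $\nu_h,\mu_h,\sigma_h$), such that for all $h_1,h_2,h_3\in H$, $y\in I$: $$\mu_{-h_1+(h_1\circ h_3)}(y)=-\nu_{h_1\circ(h_2+h_3)}(\sigma_{h_2+h_3}(\nu_{h_1}^{-1}(y)))+\mu_{-h_1+(h_1\circ h_3)}(\nu_{h_1\circ h_2}(\sigma_{h_2}(\nu_{h_1}^{-1}(y))))+\nu_{h_1\circ h_3}(\sigma_{h_3}(\nu_{h_1}^{-1}(y))),$$ $$\mu_{-h_1+(h_1\circ h_3)}(\nu_{h_1}(y))=\nu_{h_1}(\mu_{h_3}(y)).$$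 Cohomology: $C^1_N$ is the group of functions $\theta:H\to I$ with $\theta(0)=0$. $C^2_N$ is the group of pairs $(g,f)$ of functions $H\times H\to I$ vanishing whenever one argument is $0$. $\partial^1(\theta)=(g,f)$, where $g(h_1,h_2)=\theta(h_2)-\theta(h_1+h_2)+\mu_{h_2}(\theta(h_1))$ and $f(h_1,h_2)=\nu_{h_1}(\theta(h_2))-\theta(h_1\circ h_2)+\nu_{h_1\circ h_2}(\sigma_{h_2}(\nu_{h_1}^{-1}(\theta(h_1))))$. For $(g,f)\in C^2_N$, $\partial^2(g,f)=(\partial_v^{0,2}(g),\ \partial_h^{0,2}(g)-\partial_v^{1,1}(f),\ \partial_h^{1,1}(f))$, a triple of functions $H^3\to I$ with - $\partial_v^{0,2}(g)(h_1,h_2,h_3)=g(h_2,h_3)-g(h_1+h_2,h_3)+g(h_1,h_2+h_3)-\mu_{h_3}(g(h_1,h_2))$, - $\partial_h^{0,2}(g)(h_1,h_2,h_3)=\nu_{h_1}(g(h_2,h_3))+\mu_{h_1\circ h_3}(g(h_1,-h_1))-\mu_{h_1\circ h_3}(g(h_1\circ h_2,-h_1))-g((h_1\circ h_2)-h_1,h_1\circ h_3)$, - $\partial_v^{1,1}(f)(h_1,h_2,h_3)=\mu_{-h_1+(h_1\circ h_3)}(f(h_1,h_2))-f(h_1,h_2+h_3)+f(h_1,h_3)$, - $\partial_h^{1,1}(f)(h_1,h_2,h_3)=\nu_{h_1}(f(h_2,h_3))-f(h_1\circ h_2,h_3)+f(h_1,h_2\circ h_3)-\nu_{h_1\circ h_2\circ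 h_3}(\sigma_{h_3}(\nu_{h_1\circ h_2}^{-1}(f(h_1,h_2))))$. $\mathrm{Z}^2_N(H,I)=\mathrm{Ker}(\partial^2)$, $\mathrm{B}^2_N(H,I)=\mathrm{Im}(\partial^1)$ (contained in $\mathrm{Z}^2_N(H,I)$), $\mathrm{H}^2_N(H,I)=\mathrm{Z}^2_N(H,I)/\mathrm{B}^2_N(H,I)$. Extensions: an extension of $H$ by $I$ is a left skew brace $E$ with an exact sequence $0\to I\xrightarrow{i}E\xrightarrow{\pi}H\to0$ of brace homomorphisms ($i$ injective, $\pi$ surjective, $i(I)=\ker\pi$). Two extensions $E,E'$ are equivalent if there is a brace homomorphism $\phi:E\to E'$ with $\phi i=i'$ and $\pi'\phi=\pi$. A set-theoretic section (st-section) is a map $s:H\to E$ with $\pi s=\mathrm{Id}$, $s(0)=0$. Identifying $I$ with $i(I)$, the actions associated with the extension are $\nu_h(y)=-s(h)+(s(h)\circ y)$, $\mu_h(y)=-s(h)+y+s(h)$, $\sigma_h(y)=s(h)^{-1}\circ y\circ s(h)$; they form a good triplet depending only on the equivalence class of the extension. $\mathrm{Ext}_{(\nu,\mu,\sigma)}(H,I)$ is the set of equivalence classes of extensions of $H$ by $I$ whose associated triplet is $(\nu,\mu,\sigma)$. *)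

(* Defs.v *)
From HB Require Import structures.
From mathcomp Require Import all_boot all_algebra.
From mathcomp Require Import mathcomp_extra boolp classical_sets functions.

Set Implicit Arguments.
Unset Strict Implicit.
Unset Printing Implicit Defensive.

Import GRing.Theory.
Local Open Scope classical_set_scope.
Local Open Scope ring_scope.

(* The multiplicative group (E, o) of a left skew brace is the [groupType]
   structure of E, with inverse [x^-1%g].  [zmodType] is not available for the
   additive group, which need not be abelian: + and 0 are those of the
   axiom-free structure [ChoiceBaseAddUMagma], and the opposite is the separate
   operation [sbopp], since inheriting the opposite of [baseZmodType] would
   require a join that the hierarchy below [zmodType] does not have.
   That 0 is also the identity 1 of (E, o) follows from [sbmulD] at a = 1. *)
Notation "x ∘ y" := (x%R * y%R)%g (at level 40, left associativity) : ring_scope.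

HB.mixin Record isSkewBrace E of GRing.ChoiceBaseAddUMagma E & Group E := {
  sbopp : E -> E;
  sbaddA : associative (@GRing.add E);
  sbadd0 : left_id 0 (@GRing.add E);
  sbaddN : left_inverse 0 sbopp (@GRing.add E);
  sbmulD : forall a b c : E, a ∘ (b + c) = a ∘ b + sbopp a + a ∘ c
}.
#[short(type="skewBraceType")]
HB.structure Definition SkewBrace :=
  {E of isSkewBrace E & GRing.ChoiceBaseAddUMagma E & Group E}.

Notation "⊖ x" := (sbopp x) (at level 35, right associativity) : ring_scope.

Definition brace_morphism (E F : skewBraceType) (f : E -> F) : Prop :=
  {morph f : x y / x + y} /\ {morph f : x y / x ∘ y}.

Definition trivial_brace (I : zmodType) : Type := I.

Section TrivialBrace.
Variable I : zmodType.

HB.instance Definition _ := GRing.Zmodule.on (trivial_brace I).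
HB.instance Definition _ := isGroup.Build (trivial_brace I)
  (@addrA I) (@add0r I) (@addr0 I) (@addNr I) (@addrN I).

Fact trivial_brace_mulD (a b c : trivial_brace I) :
  a ∘ (b + c) = a ∘ b + (- a) + a ∘ c.
Proof.
change (a + (b + c) = a + b - a + (a + c)).
by rewrite [a + b]addrC addrK addrCA.
Qed.

HB.instance Definition _ := isSkewBrace.Build (trivial_brace I)
  (@addrA I) (@add0r I) (@addNr I) trivial_brace_mulD.
End TrivialBrace.

Record addAut (I : zmodType) := AddAut {
  addAut_fun :> {additive I -> I};
  addAut_inv : I -> I;
  addAutK : cancel addAut_fun addAut_inv;
  addAutVK : cancel addAut_inv addAut_fun
}.

Section Cohomology.
Variables (H : skewBraceType) (I : zmodType).
Variables (nu mu sigma : H -> addAut I).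

Record good_triplet : Prop := GoodTriplet {
  good_nu_morph : forall h1 h2 y, nu (h1 ∘ h2) y = nu h1 (nu h2 y);
  good_mu_antimorph : forall h1 h2 y, mu (h1 + h2) y = mu h2 (mu h1 y);
  good_sigma_antimorph : forall h1 h2 y,
    sigma (h1 ∘ h2) y = sigma h2 (sigma h1 y);
  good_compat : forall h1 h2 h3 y,
    mu (⊖ h1 + h1 ∘ h3) y =
      - nu (h1 ∘ (h2 + h3)) (sigma (h2 + h3) (addAut_inv (nu h1) y))
      + mu (⊖ h1 + h1 ∘ h3) (nu (h1 ∘ h2) (sigma h2 (addAut_inv (nu h1) y)))
      + nu (h1 ∘ h3) (sigma h3 (addAut_inv (nu h1) y));
  good_mu_nu : forall h1 h3 y,
    mu (⊖ h1 + h1 ∘ h3) (nu h1 y) = nu h1 (mu h3 y)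
}.

Definition cochain2 : Type := ((H -> H -> I) * (H -> H -> I))%type.
Definition map3 : Type := H -> H -> H -> I.

Definition C1N : set (H -> I) := [set theta | theta 0 = 0].

Definition C2N : set cochain2 :=
  [set c | forall h, [/\ c.1 0 h = 0, c.1 h 0 = 0, c.2 0 h = 0 & c.2 h 0 = 0]].

Definition d1 (theta : H -> I) : cochain2 :=
  (fun h1 h2 => theta h2 - theta (h1 + h2) + mu h2 (theta h1),
   fun h1 h2 => nu h1 (theta h2) - theta (h1 ∘ h2)
                + nu (h1 ∘ h2) (sigma h2 (addAut_inv (nu h1) (theta h1)))).

Definition dv02 (g : H -> H -> I) : map3 := fun h1 h2 h3 =>
  g h2 h3 - g (h1 + h2) h3 + g h1 (h2 + h3) - mu h3 (g h1 h2).

Definition dh02 (g : H -> H -> I) : map3 := fun h1 h2 h3 =>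
  nu h1 (g h2 h3) + mu (h1 ∘ h3) (g h1 (⊖ h1))
  - mu (h1 ∘ h3) (g (h1 ∘ h2) (⊖ h1))
  - g (h1 ∘ h2 + ⊖ h1) (h1 ∘ h3).

Definition dv11 (f : H -> H -> I) : map3 := fun h1 h2 h3 =>
  mu (⊖ h1 + h1 ∘ h3) (f h1 h2) - f h1 (h2 + h3) + f h1 h3.

Definition dh11 (f : H -> H -> I) : map3 := fun h1 h2 h3 =>
  nu h1 (f h2 h3) - f (h1 ∘ h2) h3 + f h1 (h2 ∘ h3)
  - nu (h1 ∘ h2 ∘ h3) (sigma h3 (addAut_inv (nu (h1 ∘ h2)) (f h1 h2))).

Definition d2 (c : cochain2) : map3 * map3 * map3 :=
  (dv02 c.1, dh02 c.1 - dv11 c.2, dh11 c.2).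

Definition Z2N : set cochain2 :=
  [set c | C2N c /\ d2 c = 0].

Definition B2N : set cochain2 := d1 @` C1N.

Definition coset2 (c : cochain2) : set cochain2 :=
  [set c + b | b in B2N].

(* The underlying set of Z2N / B2N: its elements are the cosets. *)
Definition H2N : Type :=
  {A : set cochain2 | exists2 c, Z2N c & A = coset2 c}.

End Cohomology.

Record extension (H : skewBraceType) (I : zmodType) := Extension {
  ext_brace :> skewBraceType;
  ext_inj : trivial_brace I -> ext_brace;
  ext_proj : ext_brace -> H;
  ext_inj_morph : brace_morphism ext_inj;
  ext_proj_morph : brace_morphism ext_proj;
  ext_injP : injective ext_inj;
  ext_projP : forall h, exists e, ext_proj e = h;
  ext_exact : range ext_inj = ext_proj @^-1` [set 0]
}.

Arguments ext_inj {H I} E y : rename.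
Arguments ext_proj {H I} E e : rename.

Section Ext.
Variables (H : skewBraceType) (I : zmodType).

Definition ext_equiv (E E' : extension H I) : Prop :=
  exists phi : E -> E', [/\ brace_morphism phi,
    (forall y, phi (ext_inj E y) = ext_inj E' y) &
    (forall e, ext_proj E' (phi e) = ext_proj E e)].

Definition st_section (E : extension H I) (s : H -> E) : Prop :=
  cancel s (ext_proj E) /\ s 0 = 0.

(* The choice of the section s is immaterial: any two give the same actions. *)
Definition has_triplet (nu mu sigma : H -> addAut I) (E : extension H I) :=
  exists2 s : H -> E, st_section s & forall (h : H) (y : I),
    [/\ ext_inj E (nu h y) = ⊖ s h + s h ∘ ext_inj E y,
        ext_inj E (mu h y) = ⊖ s h + ext_inj E y + s h &
        ext_inj E (sigma h y) = (s h)^-1%g ∘ ext_inj E y ∘ s h].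

(* Classes are plain predicates rather than [set (extension H I)]: the latter
   is universe-inconsistent, as [extension H I] quantifies over all braces. *)
Definition ExtN (nu mu sigma : H -> addAut I) : Type :=
  {C : extension H I -> Prop |
    exists2 E, has_triplet nu mu sigma E & C = ext_equiv E}.

End Ext.

(* Main.v *)
Require Import Defs.
From HB Require Import structures.
From mathcomp Require Import all_boot all_algebra.
From mathcomp Require Import mathcomp_extra boolp classical_sets functions.

(* A section s of an extension E writes each e in E uniquely as s(h) + y with
   y in I, and in the coordinates (h, y) the laws of E read
     (h1, y1) + (h2, y2) = (h1 + h2, g(h1, h2) + mu_h2(y1) + y2),
     (h1, y1) ∘ (h2, y2) = (h1 ∘ h2, f(h1, h2) + T(y1) + nu_h1(y2)),
   where T = nu_(h1 ∘ h2) sigma_h2 nu_h1^-1.  The brace axioms for these laws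
   amount to the good triplet conditions on y1, y2 and the cocycle conditions
   on (g, f), so extensions equipped with a section correspond to 2-cocycles.
   Replacing s by s + theta replaces (g, f) by (g, f) + d1 theta, and an
   equivalence of extensions carries sections to sections without changing
   (g, f); hence the classes of extensions are the cosets of B2N. *)

Set Implicit Arguments.
Unset Strict Implicit.
Unset Printing Implicit Defensive.

Import GRing.Theory.
Local Open Scope classical_set_scope.
Local Open Scope ring_scope.

(** * Elementary algebra of groups and skew braces *)

Lemma monoid_right_inverse_left (T : Type) (op : T -> T -> T) (e : T)
    (inv : T -> T) : associative op -> left_id e op -> right_id e op ->
  right_inverse e inv op -> left_inverse e inv op.
Proof.
move=> opA op1x opx1 opV x.
by rewrite -[LHS]opx1 -[X in op _ X](opV (inv x)) -opA [op x _]opA opV op1x opV.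
Qed.

Section SkewBraceTheory.
Variable E : skewBraceType.
Implicit Types x y z : E.

Lemma sbaddKl x y : ⊖ x + (x + y) = y.
Proof. by rewrite sbaddA sbaddN sbadd0. Qed.

Lemma sbaddIl x y z : x + y = x + z -> y = z.
Proof. by move=> /(congr1 (+%R (⊖ x))); rewrite !sbaddKl. Qed.

Lemma sbaddr0 x : x + 0 = x.
Proof. by apply: (@sbaddIl (⊖ x)); rewrite sbaddA sbaddN sbadd0. Qed.

Lemma sbaddrN x : x + ⊖ x = 0.
Proof. by apply: (@sbaddIl (⊖ x)); rewrite sbaddKl sbaddr0. Qed.

Lemma sbaddNKl x y : x + (⊖ x + y) = y.
Proof. by rewrite sbaddA sbaddrN sbadd0. Qed.

Lemma sbone : (1%g : E) = 0.
Proof.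
have := @sbmulD E 1%g 0 0; rewrite !mul1g !sbadd0 sbaddr0 => N1.
by rewrite -[LHS]sbadd0 [X in X + _]N1 sbaddN.
Qed.

Lemma sbmul0 x : 0 ∘ x = x.
Proof. by rewrite -sbone mul1g. Qed.

Lemma sbmulr0 x : x ∘ 0 = x.
Proof. by rewrite -sbone mulg1. Qed.

End SkewBraceTheory.

(** * Kernel and fibres of the projection of an extension *)

Section ExtensionTheory.
Variables (H : skewBraceType) (I : zmodType) (E : extension H I).
Local Notation i := (ext_inj E).
Local Notation p := (ext_proj E).

Lemma ext_injD (y z : I) : i (y + z : I) = i y + i z.
Proof. by case: (ext_inj_morph E) => ->. Qed.

Lemma ext_injM (y z : I) : i y ∘ i z = i y + i z.
Proof. by rewrite -ext_injD; case: (ext_inj_morph E) => _ <-. Qed.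

Lemma ext_inj0 : i (0 : I) = 0.
Proof. by apply: (@sbaddIl _ (i (0 : I))); rewrite -ext_injD addr0 sbaddr0. Qed.

Lemma ext_projD (x y : E) : p (x + y) = p x + p y.
Proof. by case: (ext_proj_morph E) => ->. Qed.

Lemma ext_projM (x y : E) : p (x ∘ y) = p x ∘ p y.
Proof. by case: (ext_proj_morph E) => _ ->. Qed.

Lemma ext_proj0 : p 0 = 0.
Proof. by apply: (@sbaddIl _ (p 0)); rewrite -ext_projD !sbaddr0. Qed.

Lemma ext_projN (x : E) : p (⊖ x) = ⊖ p x.
Proof. by apply: (@sbaddIl _ (p x)); rewrite -ext_projD !sbaddrN ext_proj0. Qed.

Lemma ext_proj_inj (y : I) : p (i y) = 0.
Proof.
have : range i (i y) by exists y.
by rewrite (ext_exact E).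
Qed.

Lemma ext_kerP (x : E) : p x = 0 -> exists y : I, x = i y.
Proof.
move=> px0; have : (p @^-1` [set 0]) x by [].
by rewrite -(ext_exact E) => -[y _ <-]; exists y.
Qed.

Lemma ext_addP (x y : E) : p x = p y -> exists z : I, y = x + i z.
Proof.
move=> pxy; have /ext_kerP[z zE] : p (⊖ x + y) = 0.
  by rewrite ext_projD ext_projN pxy sbaddN.
by exists z; rewrite -zE sbaddNKl.
Qed.

End ExtensionTheory.

(** * Coordinates on an extension given by a section *)

Section Coordinates.
Variables (H : skewBraceType) (I : zmodType).
Variables (nu mu sigma : H -> addAut I).
Hypothesis good : good_triplet nu mu sigma.
Implicit Types (E : extension H I) (c : cochain2 H I) (x y z : I).

(** How the [I]-part of a left factor passes [s h2] in a product: [s h1 + x] is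
    [s h1 ∘ nu_h1^-1(x)], [sigma_h2] moves the kernel element to the right of [s h2], and
    [nu_(h1 ∘ h2)] returns to additive coordinates. *)
Definition twist h1 h2 x : I :=
  nu (h1 ∘ h2) (sigma h2 (addAut_inv (nu h1) x)).

Lemma addAut_invD (a : addAut I) : {morph addAut_inv a : x y / x + y}.
Proof.
by move=> x y; apply: (can_inj (addAutK a)); rewrite raddfD /= !addAutVK.
Qed.

Lemma twistD h1 h2 : {morph twist h1 h2 : x y / x + y}.
Proof. by move=> x y; rewrite /twist addAut_invD !raddfD. Qed.

Lemma twist0 h1 h2 : twist h1 h2 0 = 0.
Proof. by apply: (addrI (twist h1 h2 0)); rewrite -twistD !addr0. Qed.

(* c.1 and c.2 measure the failure of s to preserve + and ∘. *)
Definition presents E (s : H -> E) c : Prop :=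
  [/\ st_section s,
      (forall h1 h2 y1 y2, (s h1 + ext_inj E y1) + (s h2 + ext_inj E y2) =
         s (h1 + h2) + ext_inj E (c.1 h1 h2 + mu h2 y1 + y2 : I)) &
      (forall h1 h2 y1 y2, (s h1 + ext_inj E y1) ∘ (s h2 + ext_inj E y2) =
         s (h1 ∘ h2) + ext_inj E (c.2 h1 h2 + twist h1 h2 y1 + nu h1 y2 : I))].

Lemma section_coord_inj E (s : H -> E) h1 h2 y1 y2 : st_section s ->
  s h1 + ext_inj E y1 = s h2 + ext_inj E y2 -> h1 = h2 /\ y1 = y2.
Proof.
move=> [sK _] eq12; have eqh : h1 = h2.
  have := congr1 (ext_proj E) eq12.
  by rewrite !ext_projD !ext_proj_inj !sbaddr0 !sK.
by split=> //; move: eq12; rewrite eqh => /sbaddIl/ext_injP.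
Qed.

Lemma section_coord E (s : H -> E) : st_section s ->
  exists q : E -> I, forall e, e = s (ext_proj E e) + ext_inj E (q e).
Proof.
move=> [sK _]; have /choice[q qP] : forall e, exists y : I,
    e = s (ext_proj E e) + ext_inj E y.
  by move=> e; apply: ext_addP; rewrite sK.
by exists q.
Qed.

(** At [y1 = y2 = 0] both laws leave only the cocycle values, and coordinates are unique. *)
Lemma presents_unique E (s : H -> E) c c' :
  presents s c -> presents s c' -> c = c'.
Proof.
case: c c' => [g f] [g' f'] [ss add mul] [_ add' mul'] /=; congr pair.
  apply/funext => h1; apply/funext => h2.
  have [_] := section_coord_inj ss (etrans (esym (add h1 h2 0 0)) (add' h1 h2 0 0)).
  by rewrite /= !addr0 => /addIr.
apply/funext => h1; apply/funext => h2.
have [_] := section_coord_inj ss (etrans (esym (mul h1 h2 0 0)) (mul' h1 h2 0 0)).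
by rewrite /= !raddf0 !addr0 => /addIr.
Qed.

(** The action formulas are rules for moving a kernel element past [s h]; with them every sum or
    product reduces to [s h1 + s h2] or [s h1 ∘ s h2], whose deviation from [s] of the result lies
    in the kernel and defines the cochain. *)
Lemma presents_of_actions E (s : H -> E) : st_section s ->
  (forall (h : H) (y : I),
    [/\ ext_inj E (nu h y) = ⊖ s h + s h ∘ ext_inj E y,
        ext_inj E (mu h y) = ⊖ s h + ext_inj E y + s h &
        ext_inj E (sigma h y) = (s h)^-1%g ∘ ext_inj E y ∘ s h]) ->
  exists c, presents s c.
Proof.
move=> ss act; have [sK s0] := ss.
have nuE h y : s h ∘ ext_inj E y = s h + ext_inj E (nu h y).
  by case: (act h y) => -> _ _; rewrite sbaddNKl.
have muE h y : ext_inj E y + s h = s h + ext_inj E (mu h y).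
  by case: (act h y) => _ -> _; rewrite -sbaddA sbaddNKl.
have sigmaE h y : ext_inj E y ∘ s h = s h ∘ ext_inj E (sigma h y).
  by case: (act h y) => _ _ ->; rewrite -mulgA mulVKg.
have /choice[g gE] : forall u : H * H, exists y : I,
    s u.1 + s u.2 = s (u.1 + u.2) + ext_inj E y.
  by move=> u; apply: ext_addP; rewrite ext_projD !sK.
have /choice[f fE] : forall u : H * H, exists y : I,
    s u.1 ∘ s u.2 = s (u.1 ∘ u.2) + ext_inj E y.
  by move=> u; apply: ext_addP; rewrite ext_projM !sK.
exists (fun h1 h2 => g (h1, h2), fun h1 h2 => f (h1, h2)); split=> //= h1 h2 y1 y2.
  rewrite -sbaddA [ext_inj E y1 + _]sbaddA muE !sbaddA (gE (h1, h2)) /=.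
  by rewrite !ext_injD !sbaddA.
have sE h y : s h + ext_inj E y = s h ∘ ext_inj E (addAut_inv (nu h) y).
  by rewrite nuE addAutVK.
rewrite sE (sE h2) -mulgA [_ ∘ (s h2 ∘ _)]mulgA sigmaE.
rewrite !mulgA (fE (h1, h2)) /= sE -!mulgA !(ext_injM, =^~ ext_injD) nuE.
rewrite /twist !raddfD /= !addAutVK.
by rewrite (good_nu_morph good _ _ (addAut_inv _ _)) addAutVK !addrA.
Qed.

(** * Actions of 0 and composition rules for [twist] *)

Lemma good_nu0 y : nu 0 y = y.
Proof.
(* An idempotent automorphism is the identity. *)
have /(can_inj (addAutK (nu 0))) -> // : nu 0 (nu 0 y) = nu 0 y.
by rewrite -(good_nu_morph good) sbmul0.
Qed.

Lemma good_mu0 y : mu 0 y = y.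
Proof.
have /(can_inj (addAutK (mu 0))) -> // : mu 0 (mu 0 y) = mu 0 y.
by rewrite -(good_mu_antimorph good) sbadd0.
Qed.

Lemma good_sigma0 y : sigma 0 y = y.
Proof.
have /(can_inj (addAutK (sigma 0))) -> // : sigma 0 (sigma 0 y) = sigma 0 y.
by rewrite -(good_sigma_antimorph good) sbmul0.
Qed.

Lemma good_nuV0 y : addAut_inv (nu 0) y = y.
Proof. by apply: (can_inj (addAutK (nu 0))); rewrite addAutVK good_nu0. Qed.

Lemma twistr0 h y : twist h 0 y = y.
Proof. by rewrite /twist good_sigma0 sbmulr0 addAutVK. Qed.

Lemma twist0l h y : twist 0 h y = nu h (sigma h y).
Proof. by rewrite /twist sbmul0 good_nuV0. Qed.

(** In the associativity of [∘] this matches the terms in [y2], and [twist_twist] those in [y1]. *)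
Lemma twist_nu h1 h2 h3 y :
  twist (h1 ∘ h2) h3 (nu h1 y) = nu h1 (twist h2 h3 y).
Proof.
rewrite /twist -mulgA -(good_nu_morph good); congr (nu _ (sigma _ _)).
apply: (can_inj (addAutK (nu (h1 ∘ h2)))).
by rewrite addAutVK (good_nu_morph good) addAutVK.
Qed.

Lemma twist_twist h1 h2 h3 y :
  twist (h1 ∘ h2) h3 (twist h1 h2 y) = twist h1 (h2 ∘ h3) y.
Proof. by rewrite /twist addAutK mulgA (good_sigma_antimorph good). Qed.

(** * Actions and cocycle conditions read off a presentation *)

Lemma presents_normalized E (s : H -> E) c : presents s c -> C2N c.
Proof.
case=> ss add mul h; have s0 := ss.2.
have inj := section_coord_inj ss; split.
- have := add 0 h 0 0; rewrite s0 ext_inj0 !sbadd0 -[X in _ + X]ext_inj0.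
  by rewrite raddf0 /= !addr0 => /inj[].
- have := add h 0 0 0; rewrite s0 ext_inj0 !sbaddr0 -[LHS]sbaddr0 -ext_inj0.
  by rewrite !raddf0 /= !addr0 => /inj[].
- have := mul 0 h 0 0; rewrite s0 ext_inj0 sbaddr0 sbmul0.
  by rewrite sbmul0 twist0 raddf0 /= -ext_inj0 !addr0 => /inj[].
- have := mul h 0 0 0; rewrite s0 ext_inj0 !sbaddr0 sbmulr0 -[LHS]sbaddr0.
  by rewrite sbmulr0 twist0 raddf0 /= -ext_inj0 !addr0 => /inj[].
Qed.

(** Converse of [presents_of_actions]: since [s 0 = 0], the laws with one factor in the kernel and
    the other equal to [s h] are the three commutation rules. *)
Lemma presents_triplet E (s : H -> E) c : presents s c ->
  has_triplet nu mu sigma E.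
Proof.
move=> pc; have [ss add mul] := pc; exists s => // h y; have s0 := ss.2.
have [g0 _ f0 _] := presents_normalized pc h.
have [_ _ _ f0r] := presents_normalized pc h.
have sE : ext_inj E y = s 0 + ext_inj E y by rewrite s0 sbadd0.
have s0E : s h = s h + ext_inj E (0 : I) by rewrite ext_inj0 sbaddr0.
have nuE z : s h ∘ ext_inj E z = s h + ext_inj E (nu h z).
  have := mul h 0 0 z; rewrite s0 sbadd0 -s0E => ->.
  by rewrite f0r twistr0 sbmulr0 !add0r.
have muE : ext_inj E y + s h = s h + ext_inj E (mu h y).
  have := add 0 h y 0; rewrite s0 !sbadd0 -s0E => ->.
  by rewrite g0 add0r addr0.
have sigmaE : ext_inj E y ∘ s h = s h ∘ ext_inj E (sigma h y).
  have := mul 0 h y 0; rewrite s0 !sbadd0 -s0E => ->.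
  by rewrite f0 nuE twist0l raddf0 sbmul0 /= add0r addr0.
split; first by rewrite nuE sbaddKl.
  by rewrite -sbaddA muE sbaddKl.
by rewrite -mulgA sigmaE mulKg.
Qed.

(** The components of [d2 c = 0] are regrouped as the constant terms on the two sides of a brace
    axiom: associativity of [+], distributivity, associativity of [∘]. *)
Lemma Z2NP c : Z2N nu mu sigma c <-> [/\ C2N c,
  (forall h1 h2 h3, c.1 h1 (h2 + h3) + c.1 h2 h3 =
     c.1 (h1 + h2) h3 + mu h3 (c.1 h1 h2)),
  (forall h1 h2 h3, c.2 h1 (h2 + h3) + nu h1 (c.1 h2 h3) =
     c.1 (h1 ∘ h2 + ⊖ h1) (h1 ∘ h3) + mu (h1 ∘ h3) (c.1 (h1 ∘ h2) (⊖ h1))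
     - mu (h1 ∘ h3) (c.1 h1 (⊖ h1)) + mu (⊖ h1 + h1 ∘ h3) (c.2 h1 h2)
     + c.2 h1 h3) &
  (forall h1 h2 h3, c.2 h1 (h2 ∘ h3) + nu h1 (c.2 h2 h3) =
     c.2 (h1 ∘ h2) h3 + twist (h1 ∘ h2) h3 (c.2 h1 h2))].
Proof.
have subP (x y : I) : (x - y = 0) <-> (x = y).
  by split=> [/subr0_eq|->]; rewrite ?subrr.
(* [dv02] and [dh11] share this sign pattern; [eqP2] treats the mixed component. *)
have eqP1 (x y z t : I) : (x - y + z - t = 0) <-> (z + x = y + t).
  apply: iff_trans (subP _ _); rewrite opprD addrA.
  by have -> : z + x - y = x - y + z by rewrite -addrA addrC.
have eqP2 (F n A B C M f : I) : (n + A - B - C - (M - F + f) = 0) <->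
    (F + n = C + B - A + M + f).
  apply: iff_trans (subP _ _); rewrite !opprD !opprK !addrA.
  by have -> : F + n - C - B + A - M - f = n + A - B - C - M + F - f
    by rewrite [LHS](ACl (2*5*4*3*6*1*7)).
split=> [[cC /= d0]|[cC c1 c2 c3]].
  split=> // h1 h2 h3.
  - exact/eqP1/(congr1 (fun t => t.1.1 h1 h2 h3) d0).
  - exact/eqP2/(congr1 (fun t => t.1.2 h1 h2 h3) d0).
  - exact/eqP1/(congr1 (fun t => t.2 h1 h2 h3) d0).
split=> //; congr (_, _, _); apply/funext => h1; apply/funext => h2.
all: apply/funext => h3.
- exact/eqP1/c1.
- exact/eqP2/c2.
- exact/eqP1/c3.
Qed.

Lemma presents_cocycle E (s : H -> E) c : presents s c -> Z2N nu mu sigma c.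
Proof.
move=> pc; apply/Z2NP; split; first exact: presents_normalized pc.
all: case: pc => ss add mul h1 h2 h3.
all: pose a h y := s h + ext_inj E y.
- have := sbaddA (a h1 0) (a h2 0) (a h3 0).
  rewrite !add => /(section_coord_inj ss)[_].
  by rewrite !raddf0 !addr0.
- have := sbmulD (a h1 0) (a h2 0) (a h3 0).
  (* The opposite of [s h1] differs from [s (⊖ h1)] by this correction, which is where the values of
     [g] at [(h1, ⊖ h1)] in [dh02] come from. *)
  have -> : ⊖ a h1 0 = a (⊖ h1) (- c.1 h1 (⊖ h1)).
    apply: (@sbaddIl _ (a h1 0)).
    by rewrite sbaddrN add raddf0 addr0 subrr sbaddrN ss.2 ext_inj0 sbaddr0.
  rewrite !(add, mul) => /(section_coord_inj ss)[_].
  rewrite !(raddf0, twist0, addr0) => ->; congr (_ + _).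
  rewrite (good_mu_antimorph good) !raddfD raddfN /= -!addrA; congr (_ + _).
  by congr (_ + _); rewrite addrC.
- have := mulgA (a h1 0) (a h2 0) (a h3 0).
  rewrite !mul => /(section_coord_inj ss)[_].
  by rewrite !(raddf0, twist0, addr0).
Qed.

(** * Change of section and equivalence of extensions *)

Lemma presents_shift E (s : H -> E) c (theta : H -> I) :
  presents s c -> theta 0 = 0 ->
  presents (fun h => s h + ext_inj E (theta h)) (c + d1 nu mu sigma theta).
Proof.
move=> [[sK s0] add mul] theta0.
have aE h y : s h + ext_inj E (theta h) + ext_inj E y =
    s h + ext_inj E (theta h + y : I) by rewrite -sbaddA -ext_injD.
(* Both components of [d1 theta] have the shape [t - u + m]: [t] and [m] come from [theta h2] and
   [theta h1], and [u] is [theta] at the sum or product. One identity thus serves both laws. *)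
have shiftE (a m t u y z : I) :
    a + (m + y) + (t + z) = u + (a + (t - u + m) + y + z).
  by rewrite !addrA [RHS](ACl (2*5*6*3*7*1*4)) /= addrK.
split.
- split; last by rewrite s0 theta0 ext_inj0 sbaddr0.
  by move=> h; rewrite ext_projD ext_proj_inj sbaddr0 sK.
- move=> h1 h2 y1 y2; rewrite !aE add /=; congr (_ + ext_inj E _).
  by rewrite raddfD; apply: shiftE.
- move=> h1 h2 y1 y2; rewrite !aE mul /=; congr (_ + ext_inj E _).
  by rewrite raddfD twistD; apply: shiftE.
Qed.

(** The map preserving coordinates is a morphism because the same [c] governs the laws on both
    sides. *)
Lemma presents_equiv E E' (s : H -> E) (s' : H -> E') c :
  presents s c -> presents s' c -> ext_equiv E E'.
Proof.
move=> [ss add mul] [ss' add' mul']; have [q qE] := section_coord ss.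
have uq h y : q (s h + ext_inj E y) = y.
  have /(section_coord_inj ss)[_] := qE (s h + ext_inj E y) => {2}->.
  by [].
exists (fun e => s' (ext_proj E e) + ext_inj E' (q e)); split.
- split=> e1 e2.
    rewrite add' -ext_projD; congr (s' _ + ext_inj E' _).
    by rewrite {1}[e1]qE {1}[e2]qE add uq.
  rewrite mul' -ext_projM; congr (s' _ + ext_inj E' _).
  by rewrite {1}[e1]qE {1}[e2]qE mul uq.
- move=> y; have [_ s0] := ss; have [_ s0'] := ss'.
  rewrite ext_proj_inj s0' sbadd0; congr ext_inj.
  by rewrite -[X in q X]sbadd0 -s0 uq.
- by move=> e; rewrite ext_projD ext_proj_inj sbaddr0; case: ss' => ->.
Qed.

Lemma presents_transport E E' (s : H -> E) c :
  presents s c -> ext_equiv E E' -> exists s' : H -> E', presents s' c.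
Proof.
move=> [[sK s0] add mul] [phi [[phiD phiM] phii phip]].
exists (phi \o s); split.
- split=> [h|]; first by rewrite /= phip sK.
  by rewrite /= s0 -(ext_inj0 E) phii ext_inj0.
- by move=> h1 h2 y1 y2; rewrite /= -!phii -!phiD add.
- by move=> h1 h2 y1 y2; rewrite /= -!phii -!phiD -phiM mul.
Qed.

(** Two sections differ by some [theta] with values in the kernel, so [s'] presents both [c'] and
    [c + d1 theta]. *)
Lemma presents_cohomologous E (s s' : H -> E) c c' :
  presents s c -> presents s' c' -> coset2 nu mu sigma c c'.
Proof.
move=> pc pc'; have [[sK s0] _ _] := pc; have [[sK' s0'] _ _] := pc'.
have /choice[theta thetaE] : forall h, exists y : I, s' h = s h + ext_inj E y.
  by move=> h; apply: ext_addP; rewrite sK sK'.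
have theta0 : theta 0 = 0.
  have := thetaE 0; rewrite s0 s0' sbadd0 -[LHS](ext_inj0 E) => /ext_injP.
  by [].
exists (d1 nu mu sigma theta); first by exists theta.
have := presents_shift pc theta0; rewrite -(funext thetaE) => pt.
exact: presents_unique pt pc'.
Qed.

(** * The extension built from a 2-cocycle *)

Section TwistedBrace.
Variables (c : cochain2 H I) (Zc : Z2N nu mu sigma c).

(* The proofs are phantom arguments, from which the canonical instances
   recover what the brace axioms need. *)
Definition twisted of good_triplet nu mu sigma & Z2N nu mu sigma c : Type :=
  (H * I)%type.
Local Notation T := (twisted good Zc).

Definition tw_add (u v : T) : T :=
  (u.1 + v.1, c.1 u.1 v.1 + mu v.1 u.2 + v.2).
(** Like [tw_inv], found by solving for a right inverse; [monoid_right_inverse_left] then makes it a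
    left inverse. *)
Definition tw_opp (u : T) : T :=
  (⊖ u.1, - (c.1 u.1 (⊖ u.1) + mu (⊖ u.1) u.2)).
Definition tw_mul (u v : T) : T :=
  (u.1 ∘ v.1, c.2 u.1 v.1 + twist u.1 v.1 u.2 + nu u.1 v.2).
Definition tw_inv (u : T) : T :=
  (u.1^-1%g,
   addAut_inv (nu u.1) (- (c.2 u.1 u.1^-1%g + twist u.1 u.1^-1%g u.2))).
Definition tw_zero : T := (0, 0).

Lemma tw_addA : associative tw_add.
Proof.
move=> [h1 y1] [h2 y2] [h3 y3]; have [_ cA _ _] := (Z2NP c).1 Zc.
congr pair => /=; first exact: sbaddA.
rewrite !raddfD /= (good_mu_antimorph good) !addrA.
by rewrite [LHS](ACl (1*3*2*4*5)) /= cA.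
Qed.

Lemma tw_add0 : left_id tw_zero tw_add.
Proof.
move=> [h y]; have [/(_ h)[cN _ _ _] _ _ _] := (Z2NP c).1 Zc.
by congr pair => /=; rewrite ?sbadd0// cN raddf0 !add0r.
Qed.

Lemma tw_addr0 : right_id tw_zero tw_add.
Proof.
move=> [h y]; have [/(_ h)[_ cN _ _] _ _ _] := (Z2NP c).1 Zc.
by congr pair => /=; rewrite ?sbaddr0// cN good_mu0 add0r addr0.
Qed.

Lemma tw_addN : left_inverse tw_zero tw_opp tw_add.
Proof.
apply: (monoid_right_inverse_left tw_addA tw_add0 tw_addr0) => -[h y].
by congr pair => /=; rewrite ?sbaddrN// addrN.
Qed.

Lemma tw_mulA : associative tw_mul.
Proof.
move=> [h1 y1] [h2 y2] [h3 y3]; have [_ _ _ cA] := (Z2NP c).1 Zc.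
congr pair => /=; first exact: mulgA.
rewrite !raddfD !twistD /= twist_twist twist_nu (good_nu_morph good) !addrA.
by rewrite [LHS](ACl (1*3*2*4*5)) /= cA.
Qed.

Lemma tw_mul0 : left_id tw_zero tw_mul.
Proof.
move=> [h y]; have [/(_ h)[_ _ cN _] _ _ _] := (Z2NP c).1 Zc.
by congr pair => /=; rewrite ?sbmul0// cN twist0 good_nu0 !add0r.
Qed.

Lemma tw_mulr0 : right_id tw_zero tw_mul.
Proof.
move=> [h y]; have [/(_ h)[_ _ _ cN] _ _ _] := (Z2NP c).1 Zc.
by congr pair => /=; rewrite ?sbmulr0// cN twistr0 raddf0 add0r addr0.
Qed.

Lemma tw_mulrV : right_inverse tw_zero tw_inv tw_mul.
Proof.
move=> [h y]; congr pair => /=; first by rewrite mulgV sbone.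
by rewrite addAutVK addrN.
Qed.

Lemma tw_mulV : left_inverse tw_zero tw_inv tw_mul.
Proof. exact: (monoid_right_inverse_left tw_mulA tw_mul0 tw_mulr0 tw_mulrV). Qed.

(** Compared term by term: constants agree by the mixed cocycle condition, terms in [y1] by
    [good_compat], terms in [y2] by [good_mu_nu]. *)
Lemma tw_mulD u v w :
  tw_mul u (tw_add v w) = tw_add (tw_add (tw_mul u v) (tw_opp u)) (tw_mul u w).
Proof.
case: u v w => [h1 y1] [h2 y2] [h3 y3]; have [_ _ cM _] := (Z2NP c).1 Zc.
congr pair => /=; first exact: sbmulD.
(* [good_compat] solved for its first term; the negative summand is the contribution of
   [tw_opp u]. *)
have twE : twist h1 (h2 + h3) y1 =
    mu (⊖ h1 + h1 ∘ h3) (twist h1 h2 y1) - mu (⊖ h1 + h1 ∘ h3) y1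
    + twist h1 h3 y1.
  rewrite [X in _ - X + _](good_compat good h1 h2) -!/(twist _ _ _).
  by rewrite !opprD opprK !addrA subrK [_ + twist _ (_ + _) _]addrC addrK.
rewrite opprD !raddfD !raddfN /= -!(good_mu_antimorph good) !addrA.
rewrite (good_mu_nu good) [LHS](ACl (1*3*2*4*5)) /= cM twE !addrA.
by rewrite [LHS](ACl (1*2*4*6*9*3*7*5*8*10)).
Qed.

HB.instance Definition _ := Choice.copy T (H * I)%type.
HB.instance Definition _ := GRing.hasAdd.Build T tw_add.
HB.instance Definition _ := GRing.hasZero.Build T tw_zero.
HB.instance Definition _ :=
  isGroup.Build T tw_mulA tw_mul0 tw_mulr0 tw_mulV tw_mulrV.
HB.instance Definition _ :=
  isSkewBrace.Build T tw_addA tw_add0 tw_addN tw_mulD.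

Definition tw_inj (y : trivial_brace I) : T := (0, y).
Definition tw_proj (u : T) : H := u.1.

Lemma tw_inj_morph : brace_morphism tw_inj.
Proof.
have [/(_ 0)[g0 _ f0 _] _ _ _] := (Z2NP c).1 Zc.
split=> y z; congr pair => /=; rewrite ?sbadd0 ?sbmul0//.
  by rewrite g0 good_mu0 add0r.
by rewrite f0 twistr0 good_nu0 add0r.
Qed.

Lemma tw_proj_morph : brace_morphism tw_proj.
Proof. by []. Qed.

Lemma tw_injP : injective tw_inj.
Proof. by move=> y z []. Qed.

Lemma tw_projP h : exists u, tw_proj u = h.
Proof. by exists (h, 0). Qed.

Lemma tw_exact : range tw_inj = tw_proj @^-1` [set 0].
Proof.
apply/seteqP; split=> [_ [y _ <-]//|[h y] /= h0].
by exists y => //; rewrite /tw_inj -h0.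
Qed.

Definition twisted_ext : extension H I :=
  Extension tw_inj_morph tw_proj_morph tw_injP tw_projP tw_exact.

Lemma presents_twisted : presents (E := twisted_ext) (fun h => (h, 0)) c.
Proof.
have [cN _ _ _] := (Z2NP c).1 Zc.
(* Once the coordinates of a pair are the pair itself, both laws hold by definition of [tw_add] and
   [tw_mul]. *)
have coordE h y : ((h, 0) : twisted_ext) + ext_inj twisted_ext y = (h, y).
  have [_ gN _ _] := cN h.
  by congr pair => /=; rewrite ?sbaddr0// gN raddf0 !add0r.
by split=> [//|h1 h2 y1 y2|h1 h2 y1 y2]; rewrite !coordE.
Qed.

End TwistedBrace.

(** * Cosets of coboundaries and classes of extensions *)

Lemma coset2P c c' : coset2 nu mu sigma c c' <->
  exists2 theta, theta 0 = 0 & c' = c + d1 nu mu sigma theta.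
Proof.
split=> [[_ [theta ? <-] <-]|[theta ? ->]]; first by exists theta.
by exists (d1 nu mu sigma theta) => //; exists theta.
Qed.

(** Each member of one coset is presented by a shifted section of [E], hence is cohomologous to the
    other cocycle; cosets are compared through sections of a common extension. *)
Lemma coset2_eq E (s s' : H -> E) c c' : presents s c -> presents s' c' ->
  coset2 nu mu sigma c = coset2 nu mu sigma c'.
Proof.
suff sub (t t' : H -> E) b b' : presents t b -> presents t' b' ->
    coset2 nu mu sigma b `<=` coset2 nu mu sigma b'.
  by move=> pc pc'; apply/seteqP; split; [exact: sub pc pc'|exact: sub pc' pc].
move=> pb pb' x /coset2P[theta theta0 ->].
exact: presents_cohomologous pb' (presents_shift pb theta0).
Qed.

(** Describes the class of [E] through the coset of [c] alone, which makes the map from cosets to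
    classes well defined. *)
Lemma ext_equiv_coset2 E (s : H -> E) c : presents s c ->
  ext_equiv E = fun F =>
    exists t : H -> F, exists2 b, coset2 nu mu sigma c b & presents t b.
Proof.
move=> pc; apply/funext => F; apply/propext; split.
  move=> /(presents_transport pc)[t pt]; exists t, c => //.
  exact: (presents_cohomologous pc pc).
move=> [t [_ /coset2P[theta theta0 ->] pt]].
exact: presents_equiv (presents_shift pc theta0) pt.
Qed.

End Coordinates.

Theorem theoremA (H : skewBraceType) (I : zmodType)
    (nu mu sigma : H -> addAut I) (good : good_triplet nu mu sigma) :
  exists f : H2N nu mu sigma -> ExtN nu mu sigma, bijective f.
Proof.
(* Quantifying over all members of the coset avoids choosing a representative. *)
pose cls (A : set (cochain2 H I)) (F : extension H I) : Prop :=
  exists t : H -> F, exists2 b, A b & presents nu mu sigma t b.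
have clsP (A : H2N nu mu sigma) : exists2 E : extension H I,
    has_triplet nu mu sigma E & cls (sval A) = ext_equiv E.
  case: A => _ /= [c Zc ->]; have pc := presents_twisted good Zc.
  exists (twisted_ext good Zc); first exact: (presents_triplet good pc).
  by rewrite (ext_equiv_coset2 pc).
pose f A : ExtN nu mu sigma := exist _ (cls (sval A)) (clsP A).
have f_inj : injective f.
  move=> [A [c Zc cA]] [A' [c' Zc' cA']] /(congr1 sval) /= eq_cls.
  apply: eq_exist; move: eq_cls; rewrite {}cA {}cA' => eq_cls.
  have pc := presents_twisted good Zc; have pc' := presents_twisted good Zc'.
  (* The extension built from [c] lies in its own class, hence in that of [c']; so it has a section
     presenting some [c' + d1 theta], which links the two cosets. *)
  have : cls (coset2 nu mu sigma c) (twisted_ext good Zc).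
    exists (fun h => (h, 0)), c => //; exact: (presents_cohomologous pc pc).
  rewrite eq_cls => -[t [b /coset2P[theta theta0 ->] pt]].
  rewrite (coset2_eq pc pt).
  exact: (coset2_eq (presents_shift pc' theta0) pc').
have f_surj C : exists A, f A = C.
  case: C => C [E [s ss act] CE]; have [c pc] := presents_of_actions good ss act.
  pose A : H2N nu mu sigma := exist _ (coset2 nu mu sigma c)
    (ex_intro2 _ _ c (presents_cocycle good pc) erefl).
  by exists A; apply: eq_exist; rewrite CE (ext_equiv_coset2 pc).
have [g gK] := choice f_surj.
by exists f, g => // A; apply: f_inj; rewrite gK.
Qed.
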